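(* Let $V_h\subset V$ and $W_h\subset L^2(\Omega_d;\mathbb{R}^m)$ be finite-dimensional subspaces (indexed by $h$) satisfying the discrete inf-sup condition $$\inf_{w\in W_h}\sup_{v\in V_h}\frac{b(v,w)}{\|v\|_V\,\|w\|_{Q'}}=\mu_h>\mu_0>0 ,$$ with $\mu_0$ independent of $h$. Let $\{\alpha_k\}_{k\ge 1}$ be positive real numbers. Assume that $\psi_h^0\in W_h$ is chosen such that $\nabla\mathcal{R}^*(\psi_h^0)\in V$ and $\|\nabla\mathcal{R}^*(\psi_h^0)\|_V\le c$ for some constant $c$ independent of $h$. For $k\ge1$ let $(u_h^k,\psi_h^k)\in V_h\times W_h$ be the solution of $$\alpha_k\,\mathcal{A}(u_h^k,v_h)+b(v_h,\psi_h^k-\psi_h^{k-1})=\alpha_k F(v_h)\quad\forall v_h\in V_h,\qquad b(u_h^k,w_h)-(\nabla\mathcal{R}^*(\psi_h^k),w_h)_{\Omega_d}=0\quad\forall w_h\in W_h ,$$ let $\lambda_h^k=(\psi_h^{k-1}-\psi_h^k)/\alpha_k$, and define the weighted averages $$\overline u_h^\ell=\frac{\sum_{k=1}^\ell\alpha_ku_h^k}{\sum_{k=1}^\ell\alpha_k},\qquad \overline\lambda_h^\ell=\frac{\sum_{k=1}^\ell\alpha_k\lambda_h^k}{\sum_{k=1}^\ell\alpha_k}=\frac{\psi_h^0-\psi_h^\ell}{\sum_{k=1}^\ell\alpha_k}.$$ Then for every $\ell\ge1$, $$\|\overline u_h^\ell\|_V^2+\|\overline\lambda_h^\ell\|_{Q'}\le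 C_{\mathrm{stab}},$$ where $C_{\mathrm{stab}}$ is independent of $\ell$, $\{\alpha_k\}_{k=1}^\ell$, and $h$.
   Context: **Variational setting.** $\Omega\subset\mathbb{R}^n$ ($n=1,2,3$) is a bounded Lipschitz domain; $\Omega_d\subset\overline\Omega$ is a Hausdorff-measurable set of dimension $d\le n$, with measure $\mathrm{d}\mathcal{H}_d$; $(\cdot,\cdot)_{\Omega_d}$ is the $L^2(\Omega_d;\mathbb{R}^m)$ inner product. $V$ is a Hilbert space, $\mathcal{L}:V\to V'$ is linear, $F\in V'$, and $\mathcal{A}(u,v)=\langle\mathcal{L}u,v\rangle$ (not necessarily symmetric). Put $\mathcal{A}_0(u,v)=\tfrac12(\mathcal{A}(u,v)+\mathcal{A}(v,u))$ and $\mathcal{A}_n(u,v)=\tfrac12(\mathcal{A}(u,v)-\mathcal{A}(v,u))$. It is assumed that for all $u,v\in V$: $\mathcal{A}_n(u,v)\le c_1\|u\|_V\|v\|_V$, $\mathcal{A}_0(u,v)\le C_{\mathrm{bnd}}\|u\|_V\|v\|_V$, and $\mathcal{A}(u,u)\ge C_{\mathrm{coerc}}\|u\|_V^2$, with $c_1\ge0$ and $C_{\mathrm{bnd}},C_{\mathrm{coerc}}>0$. $B:V\to Q$ is a bounded linear map whose image $Q=\operatorname{im}B$ is continuously and densely embedded in $L^2(\Omega_d;\mathbb{R}^m)$. Set $b(v,w)=(Bv,w)_{\Omega_d}$. A function $w\in L^2(\Omega_d;\mathbb{R}^m)$ is regarded as an element of the dual $Q'$ via $q\mapsto(w,q)_{\Omega_d}$,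 and $\|w\|_{Q'}$ is the corresponding dual norm. **Constraint and Legendre function.** For a.e. $x\in\Omega_d$, $C(x)\subset\mathbb{R}^m$ is a closed convex set with nonempty interior, and $\mathcal{O}=\{o\in L^2(\Omega_d;\mathbb{R}^m): o(x)\in C(x)\text{ for a.e. }x\in\Omega_d\}$. A function $L:\mathbb{R}^m\to\mathbb{R}\cup\{+\infty\}$ is called a Legendre function if it is proper with $\operatorname{int}(\operatorname{dom}L)\neq\emptyset$, strictly convex and differentiable on $\operatorname{int}(\operatorname{dom}L)$, with a singular gradient on the boundary of $\operatorname{dom}L$. $R:\Omega_d\times\mathbb{R}^m\to\mathbb{R}\cup\{+\infty\}$ is a Carathéodory function such that for a.e. $x$, $R(x,\cdot)$ is a Legendre function with $\operatorname{dom}R(x,\cdot)=C(x)$ which is supercoercive: $R(x,y)/|y|\to\infty$ as $|y|\to\infty$. $R^*(x,\cdot)$ is the convex conjugate of $R(x,\cdot)$, and $\nabla\mathcal{R}^*(\psi)(x)=\partial_zR^*(x,\psi(x))$; $\nabla\mathcal{R}^*$ is well defined and continuous on $L^\infty(\Omega_d;\mathbb{R}^m)$ and maps it into $\mathcal{O}$. Under these assumptions the discrete problems in the claim are uniquely solvable for every $k\ge1$. *)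

(* Defs.v *)
From HB Require Import structures.
From mathcomp Require Import all_boot all_order all_algebra sesquilinear.
From mathcomp Require Import all_classical all_reals all_analysis.
From mathcomp Require Import measurable_realfun.

Set Implicit Arguments.
Unset Strict Implicit.
Unset Printing Implicit Defensive.
Import Order.TTheory GRing.Theory Num.Theory.
Import numFieldNormedType.Exports.

Local Open Scope classical_set_scope.
Local Open Scope ring_scope.

Section euclidean.
Context {R : realType}.

Definition dotv {n} (x y : 'rV[R]_n) : R := \sum_i x 0 i * y 0 i.

(* The library norm of 'rV[R]_n is the max norm; it induces the same topology
   but not the same diameters. *)
Definition enorm {n} (x : 'rV[R]_n) : R := Num.sqrt (dotv x x).

Definition frontier {T : topologicalType} (A : set T) : set T :=
  closure A `\` interior A.

(* Near each boundary point, up to an orthogonal change of coordinates [U], the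
   set is the strict epigraph, in the direction of the [i]-th coordinate, of a
   Lipschitz function of the remaining coordinates. *)
Definition lipschitz_boundary {n} (Omega : set 'rV[R]_n) : Prop :=
  forall x, frontier Omega x ->
  exists (U : 'M[R]_n) (i : 'I_n) (phi : 'rV[R]_n.-1 -> R) (K r : R),
    [/\ U *m U^T = 1%:M, 0 < r,
        forall y z, `|phi y - phi z| <= K * enorm (y - z) &
        forall y, enorm (y - x) < r ->
          (Omega y <-> phi (col' i (y *m U)) < (y *m U) 0 i)].

Definition bounded_lipschitz_domain {n} (Omega : set 'rV[R]_n) : Prop :=
  [/\ Omega !=set0, open Omega, connected Omega, bounded_set Omega &
      lipschitz_boundary Omega].

End euclidean.

Section hausdorff.
Context {R : realType} {n : nat}.
Implicit Types (A U : set 'rV[R]_n) (s delta : R).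
Local Open Scope ereal_scope.

(* [diam set0] is -oo. *)
Definition diam U : \bar R :=
  ereal_sup [set (enorm (xy.1 - xy.2))%:E | xy in U `*` U].

Definition hgauge s U : \bar R :=
  if U == set0 then 0 else poweR (diam U) s.

Definition hausdorff_content s delta A : \bar R :=
  ereal_inf [set \sum_(k <oo) hgauge s (U k) |
    U in [set U : (set 'rV[R]_n)^nat |
      (forall k, diam (U k) <= delta%:E) /\ A `<=` \bigcup_k U k]].

Definition Gamma s : R :=
  (\int[lebesgue_measure]_(t in `]0%R, +oo[) (t `^ (s - 1) * expR (- t)))%R.

(* Volume of the s-dimensional Euclidean ball of diameter 1, so that for integer
   s the measure below agrees with s-dimensional volume. *)
Definition hausdorff_const s : R :=
  (pi `^ (s / 2) / Gamma (s / 2 + 1) / 2 `^ s)%R.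

Definition hausdorff s A : \bar R :=
  (hausdorff_const s)%:E *
  ereal_sup [set hausdorff_content s delta A | delta in [set e | (0 < e)%R]].

Definition hausdorff_dim A : \bar R :=
  ereal_inf [set s%:E | s in [set s | (0 <= s)%R /\ hausdorff s A = 0]].

Lemma hgauge_ge0 s U : 0 <= hgauge s U.
Proof. by rewrite /hgauge; case: ifP => // _; exact: poweR_ge0. Qed.

Lemma hausdorff_const_ge0 s : (0 <= hausdorff_const s)%R.
Proof.
rewrite /hausdorff_const !mulr_ge0 ?invr_ge0 ?powR_ge0//.
by apply: Rintegral_ge0 => t _; rewrite mulr_ge0 ?powR_ge0 ?expR_ge0.
Qed.

Let T' := g_sigma_algebraType (@setT (set 'rV[R]_n)).

Let gauge_cut s delta (U : set T') : \bar R :=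
  if diam U <= delta%:E then hgauge s U else +oo.

Let gauge_cut_ge0 s delta U : 0 <= gauge_cut s delta U.
Proof. by rewrite /gauge_cut; case: ifP => // _; exact: hgauge_ge0. Qed.

Let diam0 : diam set0 = -oo.
Proof. by rewrite /diam setX0 image_set0 ereal_sup0. Qed.

Let gauge_cut0 s delta : gauge_cut s delta set0 = 0.
Proof. by rewrite /gauge_cut diam0 leNye /hgauge eqxx. Qed.

Let hausdorff_contentE s delta :
  hausdorff_content s delta = mu_ext (gauge_cut s delta).
Proof.
apply/funext => A; apply/eqP; rewrite eq_le; apply/andP; split.
- apply: le_ereal_inf_tmp => _ [U [_ AU] <-].
  have [Ud|] := pselect (forall k, diam (U k) <= delta%:E).
    apply: ereal_inf_lbound; exists U => //.
    by apply: eq_eseriesr => k _; rewrite /gauge_cut Ud.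
  move/existsNP => [k /negP Uk].
  rewrite (@eseries_pinfty _ _ _ k) ?leey//.
  + by move=> j _; rewrite gt_eqF// (lt_le_trans _ (gauge_cut_ge0 _ _ _)).
  + by rewrite /gauge_cut (negbTE Uk).
- apply: le_ereal_inf_tmp => _ [U [Ud AU] <-].
  apply: ereal_inf_lbound; exists U.
    by split=> // i; exact: sub_sigma_algebra.
  by apply: eq_eseriesr => k _; rewrite /gauge_cut Ud.
Qed.

Let hausdorff_content_ge0 s delta A : 0 <= hausdorff_content s delta A.
Proof. by rewrite hausdorff_contentE; apply: mu_ext_ge0; exact: gauge_cut_ge0. Qed.

Let sup_content_ge0 s A :
  0 <= ereal_sup [set hausdorff_content s delta A | delta in [set e | (0 < e)%R]].
Proof.
apply: (le_trans (hausdorff_content_ge0 s 1%R A)).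
by apply: ereal_sup_ubound; exists 1%R => //=; exact: ltr01.
Qed.

Let hausdorff0 s : hausdorff s set0 = 0.
Proof.
rewrite /hausdorff (_ : ereal_sup _ = 0) ?mule0//.
apply/eqP; rewrite eq_le sup_content_ge0 andbT.
apply: ge_ereal_sup => _ [delta _ <-].
by rewrite hausdorff_contentE mu_ext0//; exact: gauge_cut_ge0.
Qed.

Let hausdorff_ge0 s A : 0 <= hausdorff s A.
Proof. by rewrite mule_ge0 ?lee_fin ?hausdorff_const_ge0. Qed.

Let le_hausdorff s : {homo hausdorff s : A B / A `<=` B >-> A <= B}.
Proof.
move=> A B AB; apply: lee_wpmul2l; first by rewrite lee_fin hausdorff_const_ge0.
apply: ge_ereal_sup => _ [delta d0 <-].
apply: (@le_trans _ _ (hausdorff_content s delta B)).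
  by rewrite hausdorff_contentE; exact: le_mu_ext.
by apply: ereal_sup_ubound; exists delta.
Qed.

Let hausdorff_sigma_subadditive s : sigma_subadditive (hausdorff s).
Proof.
move=> F; rewrite /hausdorff nneseriesZl; last by move=> *; exact: sup_content_ge0.
apply: lee_wpmul2l; first by rewrite lee_fin hausdorff_const_ge0.
apply: ge_ereal_sup => _ [delta d0 <-].
apply: (@le_trans _ _ (\sum_(i <oo) hausdorff_content s delta (F i))).
  rewrite hausdorff_contentE.
  by apply: mu_ext_sigma_subadditive; exact: gauge_cut_ge0.
apply: lee_nneseries => [i _ _|i _]; first exact: hausdorff_content_ge0.
by apply: ereal_sup_ubound; exists delta.
Qed.

HB.instance Definition _ s := isOuterMeasure.Build R 'rV[R]_n (hausdorff s)
  (hausdorff0 s) (hausdorff_ge0 s) (@le_hausdorff s)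
  (@hausdorff_sigma_subadditive s).

End hausdorff.

Section hausdorff_measure.
Context {R : realType} {n : nat}.

(* R^n with the sigma-algebra of the d-dimensional Hausdorff measurable sets. *)
Definition hspace (d : R) : Type := caratheodory_type (@hausdorff R n d).
HB.instance Definition _ d := Measurable.on (hspace d).

Definition hausdorff_measure (d : R) : set (hspace d) -> \bar R := hausdorff d.
HB.instance Definition _ d := isMeasure.Build _ _ _ (@hausdorff_measure d)
  (caratheodory_measure0 (@hausdorff R n d))
  (@caratheodory_measure_ge0 _ _ (@hausdorff R n d))
  (@caratheodory_measure_sigma_additive _ _ (@hausdorff R n d)).

Definition hausdorff_on (d : R) (D : set (hspace d)) (mD : measurable D) :
    {measure set (hspace d) -> \bar R} := mrestr (@hausdorff_measure d) mD.

End hausdorff_measure.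
Arguments hspace {R} n d.

Section lebesgue_spaces.
Context {disp : measure_display} {T : measurableType disp} {R : realType}.
Context (mu : {measure set T -> \bar R}) (m : nat).

(* Elements are representatives: two of them are the same element of
   L^2(mu; R^m) when they agree mu-almost everywhere. *)
Definition L2 : Type := {ffun 'I_m -> LfunType mu (lee1n 2)}.
HB.instance Definition _ := GRing.Lmodule.on L2.

Definition Linf : Type := {ffun 'I_m -> LfunType mu (leey 1)}.
HB.instance Definition _ := GRing.Lmodule.on Linf.

Definition vval {p : \bar R} {p1 : (1 <= p)%E}
  (f : {ffun 'I_m -> LfunType mu p1}) (x : T) : 'rV[R]_m := \row_i f i x.

Definition ip2 (f g : L2) : R := \int[mu]_x dotv (vval f x) (vval g x).

Definition norm2 (f : L2) : R := Num.sqrt (ip2 f f).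

Definition normoo (f : Linf) : \bar R :=
  Lnorm mu +oo%E (EFin \o (fun x => enorm (vval f x))).

End lebesgue_spaces.

Section convex_analysis.
Context {R : realType} {m : nat}.
Implicit Types (f : 'rV[R]_m -> \bar R) (y z g : 'rV[R]_m).

Definition grad (f : 'rV[R]_m -> R) z : 'rV[R]_m :=
  \row_i 'D_(delta_mx 0 i) f z.

Definition has_grad f z g : Prop :=
  [/\ \forall y \near z, f y \is a fin_num,
      differentiable (fine \o f) z &
      grad (fine \o f) z = g].

Definition edom f : set 'rV[R]_m := [set y | (f y < +oo)%E].

Definition proper_fun f : Prop := (forall y, f y != -oo%E) /\ edom f !=set0.

Definition strictly_convex_on (D : set 'rV[R]_m) f : Prop :=
  forall y z (t : R), D y -> D z -> y != z -> 0 < t < 1 ->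
    (f (t *: y + (1 - t) *: z)%R < t%:E * f y + (1 - t)%:E * f z)%E.

Definition legendre f : Prop :=
  [/\ proper_fun f /\ interior (edom f) !=set0,
      strictly_convex_on (interior (edom f)) f,
      forall y, interior (edom f) y -> differentiable (fine \o f) y &
      forall y, frontier (edom f) y ->
        enorm (grad (fine \o f) z) @[z --> within (interior (edom f)) (nbhs y)]
          --> +oo].

Definition supercoercive f : Prop :=
  forall M : R, exists r : R,
    forall y, r < enorm y -> ((M * enorm y)%:E <= f y)%E.

Definition conjugate f z : \bar R :=
  ereal_sup [set ((dotv z y)%:E - f y)%E | y in setT].

End convex_analysis.

Section integrand.
Context {disp : measure_display} {T : measurableType disp} {R : realType}.
Context (mu : {measure set T -> \bar R}) {m : nat}.
Context (D : set T) (C : T -> set 'rV[R]_m) (Rf : T -> 'rV[R]_m -> \bar R).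

Definition admissible (o : L2 mu m) : Prop :=
  \forall x \ae mu, C x (vval o x).

(* A function equal to +oo off a closed set is not continuous into the extended
   reals on all of R^m; continuity in [y] is on the effective domain. *)
Definition caratheodory_integrand : Prop :=
  (forall y, measurable_fun D (Rf ^~ y)) /\
  (\forall x \ae mu, {within edom (Rf x), continuous (Rf x)}).

(* [g] is the superposition x |-> d_z R^*(x, psi(x)), mu-almost everywhere. *)
Definition grad_conj (psi g : T -> 'rV[R]_m) : Prop :=
  \forall x \ae mu, has_grad (conjugate (Rf x)) (psi x) (g x).

Definition grad_conj_regular : Prop :=
  (forall psi : Linf mu m,
     exists2 g : L2 mu m, grad_conj (vval psi) (vval g) & admissible g) /\
  (forall (psi : Linf mu m) (g : L2 mu m),
     grad_conj (vval psi) (vval g) -> forall e : R, 0 < e ->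
     exists2 delta : R, 0 < delta &
       forall (psi' : Linf mu m) (g' : L2 mu m),
         grad_conj (vval psi') (vval g') ->
         (normoo (psi' - psi)%R < delta%:E)%E -> norm2 (g' - g) < e).

End integrand.

Section abstract_spaces.
Context {R : realType}.

Definition findim_subspace {E : lmodType R} (S : set E) : Prop :=
  exists s : seq E,
    S = [set v | exists c : 'I_(size s) -> R, v = \sum_i c i *: s`_i].

Definition symm_part {V : Type} (A : V -> V -> R) (u v : V) : R :=
  2^-1 * (A u v + A v u).

Definition skew_part {V : Type} (A : V -> V -> R) (u v : V) : R :=
  2^-1 * (A u v - A v u).

Definition dual_norm {Q : normedModType R} (phi : Q -> R) : R :=
  sup [set `|phi q| | q in [set q | `|q| <= 1]].

Definition wavg {E : lmodType R} (alpha : nat -> R) (x : nat -> E) (l : nat) : E :=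
  (\sum_(1 <= k < l.+1) alpha k)^-1 *: \sum_(1 <= k < l.+1) alpha k *: x k.

Definition multiplier {E : lmodType R} (alpha : nat -> R) (psi : nat -> E)
  (k : nat) : E := (alpha k)^-1 *: (psi k.-1 - psi k).

Lemma wavg_multiplier {E : lmodType R} (alpha : nat -> R) (psi : nat -> E) l :
  (forall k, (1 <= k)%N -> 0 < alpha k) ->
  wavg alpha (multiplier alpha psi) l =
  (\sum_(1 <= k < l.+1) alpha k)^-1 *: (psi 0%N - psi l).
Proof.
move=> alpha_gt0; congr (_ *: _).
rewrite big_add1 /= big_mkord.
rewrite (eq_bigr (fun k : 'I_l => - (psi k.+1 - psi k))) => [|k _].
  by rewrite sumrN -(big_mkord xpredT (fun k => psi k.+1 - psi k))
    telescope_sumr// opprB.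
by rewrite /multiplier scalerA divff ?gt_eqF ?alpha_gt0// scale1r opprB.
Qed.

End abstract_spaces.

Section mixed_problem.
Context {disp : measure_display} {T : measurableType disp} {R : realType}.
Context {mu : {measure set T -> \bar R}} {m : nat}.
Context {V Q : normedModType R} (j : {linear Q -> L2 mu m}) (B : {linear V -> Q}).

(* Since L2 consists of representatives, injectivity of [j] is modulo a.e.
   equality. *)
Definition dense_embedding : Prop :=
  [/\ forall q, norm2 (j q) = 0 -> q = 0,
      exists K : R, forall q, norm2 (j q) <= K * `|q| &
      forall (f : L2 mu m) (e : R), 0 < e -> exists q, norm2 (f - j q) < e].

Definition bform (v : V) (w : L2 mu m) : R := ip2 (j (B v)) w.

Definition Qdual_norm (w : L2 mu m) : R := dual_norm (fun q => ip2 w (j q)).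

Definition infsup (Vh : set V) (Wh : set (L2 mu m)) : \bar R :=
  ereal_inf [set ereal_sup [set (bform v w / (`|v| * Qdual_norm w))%:E |
                              v in [set v | Vh v /\ v != 0]] |
               w in [set w | Wh w /\ norm2 w != 0]].

Context (A : V -> V -> R) (F : V -> R) (Rf : T -> 'rV[R]_m -> \bar R).

(* One proximal step from [psi_old] with parameter [a]; being a solution
   includes that grad R^*(psi) is an L^2 function. *)
Definition proximal_step (Vh : set V) (Wh : set (L2 mu m)) (a : R)
    (psi_old : L2 mu m) (u : V) (psi : L2 mu m) : Prop :=
  [/\ Vh u, Wh psi,
      forall v, Vh v -> a * A u v + bform v (psi - psi_old) = a * F v &
      exists2 g : L2 mu m, grad_conj mu Rf (vval psi) (vval g) &
        forall w, Wh w -> bform u w - ip2 g w = 0].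

End mixed_problem.

(* Main.v *)
(* Testing step [k] with [u^k] and summing gives
     sum_k alpha_k A(u^k, u^k) + sum_k (g_k, psi^k - psi^(k-1))
       = sum_k alpha_k F(u^k),    g_k = grad R^*(psi^k).
   Gradients of the convex functions [R^*(x, .)] are cyclically monotone, so
   pointwise the second sum is at least [(g_0, psi^l - psi^0)]; using cyclic
   monotonicity instead of telescoping [R^*(psi^k)] avoids any question about the
   integrability of [R^*(psi^k)].  As [g_0 = B v_0] with [|v_0| <= c], coercivity
   and convexity of the square bound [|u_avg|^2] by
   [C (|u_avg| + |lambda_avg|_Q')].  Averaging the first equation yields
   [b(v, lambda_avg) = A(u_avg, v) - F(v)], so by the inf-sup condition
   [mu0 |lambda_avg|_Q' <= M |u_avg| + |F|], and the two inequalities close. *)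
Require Import Defs.
From HB Require Import structures.
From mathcomp Require Import all_boot all_order all_algebra sesquilinear.
From mathcomp Require Import all_classical all_reals all_analysis.
From mathcomp Require Import measurable_realfun.
From mathcomp Require Import ring lra.

Set Implicit Arguments.
Unset Strict Implicit.
Unset Printing Implicit Defensive.
Import Order.TTheory GRing.Theory Num.Theory.
Import numFieldNormedType.Exports.

Local Open Scope classical_set_scope.
Local Open Scope ring_scope.

(** * Real-valued integrals: a.e. comparison and finite sums *)

Section real_integral.
Context {disp : measure_display} {T : measurableType disp} {R : realType}.
Context {mu : {measure set T -> \bar R}}.
Implicit Types f g : T -> R.

(** Where [f <= g], the difference [g - f] equals its positive part, so the two have the same
    integral, and that of the positive part is nonnegative. *)
Lemma ae_le_Rintegral f g :
  mu.-integrable setT (EFin \o f) -> mu.-integrable setT (EFin \o g) ->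
  (\forall x \ae mu, f x <= g x) ->
  \int[mu]_x f x <= \int[mu]_x g x.
Proof.
move=> fi gi fg; rewrite -subr_ge0 -RintegralB//.
rewrite /Rintegral fine_ge0//.
have mD := measurable_int _ (integrableB measurableT gi fi).
set D := (X in measurable_fun _ X) in mD.
rewrite (@ae_eq_integral _ _ _ mu _ (D ^\+)%E D) //; last 2 first.
- exact: measurable_funepos.
- apply: filterS fg => x fgx _; rewrite funeposE /D /= -EFinB.
  by rewrite max_l// lee_fin subr_ge0.
by apply: integral_ge0 => x _; exact: funepos_ge0.
Qed.

Lemma integrable_sumR (I : Type) (r : seq I) (f : I -> T -> R) :
  (forall i, mu.-integrable setT (EFin \o f i)) ->
  mu.-integrable setT (EFin \o fun x => \sum_(i <- r) f i x).
Proof.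
move=> fi; rewrite (_ : _ \o _ = fun x => \sum_(i <- r) (f i x)%:E)%E.
  by apply: integrable_sum => // i _; exact: fi.
by apply/funext => x /=; rewrite sumEFin.
Qed.

Lemma Rintegral_sum (I : Type) (r : seq I) (f : I -> T -> R) :
  (forall i, mu.-integrable setT (EFin \o f i)) ->
  \int[mu]_x (\sum_(i <- r) f i x) = \sum_(i <- r) \int[mu]_x f i x.
Proof.
move=> fi; elim: r => [|i r ih].
  under eq_Rintegral do rewrite big_nil.
  by rewrite big_nil /Rintegral integral0.
under eq_Rintegral do rewrite big_cons.
by rewrite big_cons -ih RintegralD//; exact: integrable_sumR.
Qed.

End real_integral.

(** * Algebra of the Euclidean dot product *)

Section dot_product.
Context {R : realType} {m : nat}.
Implicit Types x y z : 'rV[R]_m.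

Lemma dotvC x y : dotv x y = dotv y x.
Proof. by apply: eq_bigr => i _; rewrite mulrC. Qed.

Lemma dotvDr x y z : dotv x (y + z) = dotv x y + dotv x z.
Proof. by rewrite -big_split; apply: eq_bigr => i _; rewrite mxE mulrDr. Qed.

Lemma dotvZr a x y : dotv x (a *: y) = a * dotv x y.
Proof. by rewrite mulr_sumr; apply: eq_bigr => i _; rewrite mxE mulrCA. Qed.

Lemma dotvv_ge0 x : 0 <= dotv x x.
Proof. by apply: sumr_ge0 => i _; rewrite -expr2 sqr_ge0. Qed.

End dot_product.

(** * The inner product on representatives of [L2] *)

Section L2_inner_product.
Context {disp : measure_display} {T : measurableType disp} {R : realType}.
Context {mu : {measure set T -> \bar R}} {m : nat}.
Implicit Types f g w : L2 mu m.

Lemma integrable_dotv f g :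
  mu.-integrable setT (EFin \o (fun x => dotv (vval f x) (vval g x))).
Proof.
apply: integrable_sumR => i; under [_ \o _]eq_fun do rewrite /= !mxE.
by apply/Lfun1_integrable; apply: Lfun2_mul_Lfun1; exact: LfunP.
Qed.

Lemma vvalD f g x : vval (f + g) x = vval f x + vval g x.
Proof. by apply/rowP => i; rewrite !mxE ffunE. Qed.

Lemma vvalZ a f x : vval (a *: f) x = a *: vval f x.
Proof. by apply/rowP => i; rewrite !mxE ffunE. Qed.

Lemma vvalB f g x : vval (f - g) x = vval f x - vval g x.
Proof. by rewrite vvalD -scaleN1r vvalZ scaleN1r. Qed.

Lemma ip2C f g : ip2 f g = ip2 g f.
Proof. by apply: eq_Rintegral => x _; rewrite dotvC. Qed.

Lemma ip2Dr w f g : ip2 w (f + g) = ip2 w f + ip2 w g.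
Proof.
rewrite /ip2 -RintegralD//; [|exact: integrable_dotv..].
by apply: eq_Rintegral => x _; rewrite vvalD dotvDr.
Qed.

Lemma ip2Zr a w f : ip2 w (a *: f) = a * ip2 w f.
Proof.
rewrite /ip2 -RintegralZl//; last exact: integrable_dotv.
by apply: eq_Rintegral => x _; rewrite vvalZ dotvZr.
Qed.

Lemma ip2Br w f g : ip2 w (f - g) = ip2 w f - ip2 w g.
Proof. by rewrite ip2Dr -scaleN1r ip2Zr mulN1r. Qed.

Lemma ip20r w : ip2 w 0 = 0.
Proof. by rewrite -[X in ip2 _ X](scale0r 0) ip2Zr mul0r. Qed.

Lemma ip2Dl w f g : ip2 (f + g) w = ip2 f w + ip2 g w.
Proof. by rewrite !(ip2C _ w) ip2Dr. Qed.

Lemma ip2Zl a w f : ip2 (a *: f) w = a * ip2 f w.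
Proof. by rewrite !(ip2C _ w) ip2Zr. Qed.

Lemma ip2Bl w f g : ip2 (f - g) w = ip2 f w - ip2 g w.
Proof. by rewrite !(ip2C _ w) ip2Br. Qed.

Lemma ip2vv_ge0 f : 0 <= ip2 f f.
Proof. by apply: Rintegral_ge0 => x _; exact: dotvv_ge0. Qed.

(** Expand [ip2] on the diagonal at [f + g] and [f - g]. This weak form of Cauchy-Schwarz suffices
    for finiteness of dual norms. *)
Lemma norm_ip2_le f g : 2 * `|ip2 f g| <= ip2 f f + ip2 g g.
Proof.
have := ip2vv_ge0 (f + g); have := ip2vv_ge0 (f - g).
rewrite !(ip2Bl, ip2Br) !(ip2Dl, ip2Dr) (ip2C g f).
by case: (ler0P (ip2 f g)) => _; lra.
Qed.

(* Otherwise [g] could be tested against arbitrarily large multiples of [f]. *)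
Lemma ip2_null f g : norm2 f = 0 -> ip2 f g = 0.
Proof.
move=> /eqP; rewrite sqrtr_eq0 => ff.
have {}ff : ip2 f f = 0 by apply/eqP; rewrite eq_le ff ip2vv_ge0.
apply/eqP; apply: contraT => fg0.
(* With this [t], [ip2 (t *: f) g = ip2 g g + 1], while the square of [t *: f] still integrates to
   0. *)
pose t := (ip2 g g + 1) / ip2 f g.
have := norm_ip2_le (t *: f) g.
rewrite !ip2Zl ip2Zr ff !mulr0 add0r mulfVK// ger0_norm; last first.
  by rewrite addr_ge0 ?ip2vv_ge0.
have := ip2vv_ge0 g; lra.
Qed.

Lemma norm2_sqr f : norm2 f ^+ 2 = ip2 f f.
Proof. by rewrite sqr_sqrtr ?ip2vv_ge0. Qed.

Lemma le_ip2_sum (I : Type) (r : seq I) (f g : I -> L2 mu m) f0 g0 :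
  (\forall x \ae mu, dotv (vval f0 x) (vval g0 x) <=
                     \sum_(i <- r) dotv (vval (f i) x) (vval (g i) x)) ->
  ip2 f0 g0 <= \sum_(i <- r) ip2 (f i) (g i).
Proof.
move=> h; rewrite -Rintegral_sum; last by move=> i; exact: integrable_dotv.
apply: ae_le_Rintegral h; first exact: integrable_dotv.
by apply: integrable_sumR => i; exact: integrable_dotv.
Qed.

End L2_inner_product.

(** * Convexity of conjugates and cyclic monotonicity of their gradients *)

Section conjugate_subgradient.
Context {R : realType} {m : nat}.
Implicit Types (f : 'rV[R]_m -> \bar R) (x y z g : 'rV[R]_m).

(** A conjugate is a supremum of affine functions, hence convex whatever [f] is. *)
Lemma conjugate_convex f y z (a b t : R) : 0 <= t <= 1 ->
  conjugate f y = a%:E -> conjugate f z = b%:E ->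
  (conjugate f (t *: y + (1 - t) *: z) <= (t * a + (1 - t) * b)%:E)%E.
Proof.
move=> /andP[t0 t1] ya zb; apply: ge_ereal_sup => _ [x _ <-].
have : ((dotv y x)%:E - f x <= a%:E)%E.
  by rewrite -ya; apply: ereal_sup_ubound; exists x.
have : ((dotv z x)%:E - f x <= b%:E)%E.
  by rewrite -zb; apply: ereal_sup_ubound; exists x.
have -> : dotv (t *: y + (1 - t) *: z) x = t * dotv y x + (1 - t) * dotv z x.
  by rewrite !(dotvC _ x) dotvDr !dotvZr.
(* The value [-oo] contradicts finiteness of [a]; at [+oo] the affine term is [-oo] and the bound is
   trivial. *)
case: (f x) => [r||] //=; last by move=> _ _; rewrite leNye.
rewrite -!EFinB !lee_fin => zr yr.
have : 0 <= t * (a - (dotv y x - r)) by rewrite mulr_ge0 ?subr_ge0.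
have : 0 <= (1 - t) * (b - (dotv z x - r)) by rewrite mulr_ge0 ?subr_ge0.
lra.
Qed.

Lemma derive_grad (F : 'rV[R]_m -> R) z y :
  differentiable F z -> 'D_y F z = dotv (grad F z) y.
Proof.
move=> dF; rewrite deriveE// {1}(row_sum_delta y) linear_sum.
apply: eq_bigr => i _; rewrite linearZ /= !mxE -deriveE// mulrC//.
Qed.

(** Subgradient inequality: by convexity the difference quotients from [z] towards [y], for steps in
    (0, 1], stay below the chord slope, and so does their limit at 0 from the right. *)
Lemma has_grad_conjugate_le f z g y :
  has_grad (conjugate f) z g -> conjugate f y \is a fin_num ->
  dotv g (y - z) <= fine (conjugate f y) - fine (conjugate f z).
Proof.
move=> [fin_z df <-] fin_y; rewrite -derive_grad//.
have [b zb] : exists b, conjugate f z = b%:E.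
  by exists (fine (conjugate f z)); rewrite fineK//; exact: nbhs_singleton fin_z.
have [a ya] : exists a, conjugate f y = a%:E.
  by exists (fine (conjugate f y)); rewrite fineK.
have /cvg_dnbhs_at_right dv := @diff_derivable _ _ _ _ _ (y - z) df.
rewrite zb ya /=; apply: (cvgr_to_le dv).
(* Finiteness near [z] is part of [has_grad]; it makes [fine] faithful along the start of the
   segment. *)
have fin_seg : \forall t \near (0 : R)^'+,
    conjugate f (t *: (y - z) + z) \is a fin_num.
  have c0 : (fun t : R => t *: (y - z) + z) @ (0 : R)^'+ --> z.
    apply: cvg_at_right_filter.
    have -> : nbhs z = nbhs ((0 : R) *: (y - z) + z) by rewrite scale0r add0r.
    apply: cvgD; last exact: cvg_cst.
    by apply: cvgZ; [exact: cvg_id|exact: cvg_cst].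
  exact: c0 fin_z.
near=> t.
have t0 : 0 < t by near: t; exact: nbhs_right_gt.
have t1 : t <= 1 by near: t; exact: nbhs_right_le.
have tfin : conjugate f (t *: (y - z) + z) \is a fin_num by near: t.
have := @conjugate_convex f y z a b t _ ya zb; rewrite (ltW t0) t1 => /(_ isT).
rewrite (_ : t *: y + (1 - t) *: z = t *: (y - z) + z); last first.
  by rewrite scalerBl scale1r scalerBr -addrA [- _ + z]addrC.
rewrite -(fineK tfin) lee_fin => h /=.
by rewrite zb /= /GRing.scale /= ler_pdivrMl//; lra.
Unshelve. all: by end_near. Qed.

(** The increment [phi l - phi 0] of the conjugate separates the two sides: one subgradient
    inequality at [z 0] bounds it below, and telescoping those at [z k] bounds it above. *)
Lemma cyclic_monotone f (z g : nat -> 'rV[R]_m) l :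
  (forall k, has_grad (conjugate f) (z k) (g k)) ->
  dotv (g 0%N) (z l - z 0%N) <=
    \sum_(1 <= k < l.+1) dotv (g k) (z k - z k.-1).
Proof.
move=> hg.
have fin k : conjugate f (z k) \is a fin_num.
  by have [/nbhs_singleton] := hg k.
pose phi k := fine (conjugate f (z k)).
apply: (@le_trans _ _ (phi l - phi 0%N)); first exact: has_grad_conjugate_le.
rewrite -telescope_sumr// big_add1 /=; apply: ler_sum => k _.
(* The inequality is based at the new point and evaluated at the old one, hence the sign change that
   follows. *)
have := has_grad_conjugate_le (hg k.+1) (fin k).
rewrite -(opprB (z k.+1)) -scaleN1r dotvZr /phi; lra.
Qed.

End conjugate_subgradient.

(** * Weighted averages: membership, linearity, Jensen *)

Section weighted_averages.
Context {R : realType}.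

Lemma findim_subspace_linear (E : lmodType R) (S : set E) a x y :
  findim_subspace S -> S x -> S y -> S (a *: x + y).
Proof.
move=> [s ->] [cx ->] [cy ->]; exists (fun i => a * cx i + cy i).
rewrite scaler_sumr -big_split; apply: eq_bigr => i _ /=.
by rewrite scalerDl scalerA.
Qed.

Lemma wavg_in (E : lmodType R) (S : set E) alpha (x : nat -> E) l :
  findim_subspace S -> (forall k, (1 <= k)%N -> S (x k)) ->
  S (wavg alpha x l).
Proof.
move=> Sfin Sx.
(* Zero arises as [x 1 - x 1]; [x 0] need not lie in [S]. *)
have S0 : S 0.
  rewrite -(addNr (x 1%N)) -scaleN1r.
  by apply: findim_subspace_linear; [| exact: Sx..].
rewrite /wavg -[X in S X]addr0; apply: findim_subspace_linear => //.
rewrite big_nat_cond; apply: (big_ind S) => // [y z Sy Sz|k].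
  by rewrite -[y]scale1r; exact: findim_subspace_linear.
move=> /andP[/andP[k1 _] _]; rewrite -[X in S X]addr0.
by apply: findim_subspace_linear => //; exact: Sx.
Qed.

(** Linearity is an explicit identity so that [f] can be a partial application such as [A ^~ v]. *)
Lemma linear_wavg (E : lmodType R) (f : E -> R) alpha (x : nat -> E) l :
  (forall a y z, f (a *: y + z) = a * f y + f z) ->
  f (wavg alpha x l) =
  (\sum_(1 <= k < l.+1) alpha k)^-1 * \sum_(1 <= k < l.+1) alpha k * f (x k).
Proof.
move=> flin.
have f0 : f 0 = 0.
  by have := flin (-1) 0 0; rewrite scaler0 addr0 mulN1r addNr.
rewrite /wavg -[X in f X]addr0 flin f0 addr0; congr (_ * _).
have fD : {morph f : y z / y + z}.
  by move=> y z; rewrite -[y]scale1r flin mul1r scale1r.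
by rewrite (big_morph f fD f0); apply: eq_bigr => k _; rewrite -[alpha k *: _]addr0 flin f0 addr0.
Qed.

Lemma sum_weights_gt0 (alpha : nat -> R) l :
  (forall k, (1 <= k)%N -> 0 < alpha k) -> (1 <= l)%N ->
  0 < \sum_(1 <= k < l.+1) alpha k.
Proof.
move=> alpha0 l1; rewrite big_nat_recr//= ltr_wpDl// ?alpha0//.
by rewrite big_nat_cond sumr_ge0// => k /andP[/andP[k1 _] _]; rewrite ltW ?alpha0.
Qed.

(** Jensen's inequality for the squared norm: the triangle inequality, then the tangent line of the
    square at [t]. *)
Lemma sqr_norm_wavg_le (V : normedModType R) alpha (x : nat -> V) l :
  (forall k, (1 <= k)%N -> 0 < alpha k) -> (1 <= l)%N ->
  (\sum_(1 <= k < l.+1) alpha k) * `|wavg alpha x l| ^+ 2 <=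
  \sum_(1 <= k < l.+1) alpha k * `|x k| ^+ 2.
Proof.
move=> alpha0 l1; set s := \sum_(_ <= _ < _) _; set t := `|wavg _ _ _|.
have s0 : 0 < s by exact: sum_weights_gt0.
have st : s * t <= \sum_(1 <= k < l.+1) alpha k * `|x k|.
  rewrite /t /wavg -/s normrZ gtr0_norm ?invr_gt0// mulVKf ?gt_eqF//.
  apply: le_trans (ler_norm_sum _ _ _) _.
  rewrite big_nat_cond [leRHS]big_nat_cond; apply: ler_sum => k.
  by move=> /andP[/andP[k1 _] _]; rewrite normrZ gtr0_norm// alpha0.
have t0 : 0 <= t by exact: normr_ge0.
(* [2 t |x_k| - t^2 <= |x_k|^2] *)
apply: (@le_trans _ _ (2 * t * \sum_(1 <= k < l.+1) alpha k * `|x k| - s * t ^+ 2)).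
  have := ler_wpM2l t0 st; set S := \sum_(_ <= _ < _) _; lra.
rewrite mulr_sumr mulr_suml -sumrB big_nat_cond [leRHS]big_nat_cond.
apply: ler_sum => k /andP[/andP[k1 _] _].
have := mulr_ge0 (ltW (alpha0 _ k1)) (sqr_ge0 (`|x k| - t)); lra.
Qed.

End weighted_averages.

Lemma linear_continuous_bound {R : realType} (V W : normedModType R)
    (f : {linear V -> W}) : continuous f ->
  exists2 K : R, 0 <= K & forall x, `|f x| <= K * `|x|.
Proof.
move=> /linear_bounded_continuous /linear_boundedP /pinfty_ex_gt0[K K0 Kf].
by exists K; first exact: ltW.
Qed.

(** * The dual norm of [Q] and the inf-sup condition *)

Section dual_norm_estimates.
Context {disp : measure_display} {T : measurableType disp} {R : realType}.
Context {mu : {measure set T -> \bar R}} {m : nat}.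
Context {V Q : normedModType R} (j : {linear Q -> L2 mu m}) (B : {linear V -> Q}).
Hypothesis hj : dense_embedding j.
Implicit Types w : L2 mu m.

Let Qdual_set w := [set `|ip2 w (j q)| | q in [set q | `|q| <= 1]].

Let Qdual_set0 w : Qdual_set w 0.
Proof. by exists 0; rewrite /= ?normr0// linear0 ip20r normr0. Qed.

(** Guarantees that the real [sup] in the dual norm is a genuine supremum; the bound comes from
    [norm_ip2_le] and continuity of the embedding. *)
Let Qdual_has_sup w : has_sup (Qdual_set w).
Proof.
split; first by exists 0.
have [_ [K jK] _] := hj; exists (ip2 w w + K ^+ 2) => _ [q /= q1 <-].
have := norm_ip2_le w (j q); have := normr_ge0 (ip2 w (j q)).
have : ip2 (j q) (j q) <= K ^+ 2.
  rewrite -norm2_sqr -[leRHS]real_normK ?num_real//.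
  rewrite ler_sqr ?nnegrE ?sqrtr_ge0//; apply: le_trans (jK q) _.
  by rewrite (le_trans (ler_norm _))// normrM normr_id ler_piMr.
by lra.
Qed.

Lemma Qdual_norm_ge0 w : 0 <= Qdual_norm j w.
Proof. exact: sup_upper_bound (Qdual_has_sup w) _ (Qdual_set0 w). Qed.

Lemma norm_ip2_embed_le w q : `|ip2 w (j q)| <= Qdual_norm j w * `|q|.
Proof.
have [->|q0] := eqVneq q 0; first by rewrite linear0 ip20r !normr0 mulr0.
rewrite -ler_pdivrMr ?normr_gt0//.
apply: (sup_upper_bound (Qdual_has_sup w)).
exists (`|q|^-1 *: q) => /=.
  by rewrite normrZ normfV normr_id mulVf ?normr_eq0.
by rewrite linearZ ip2Zr normrM normfV normr_id mulrC.
Qed.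

(** Covers the representatives that are null a.e., which the infimum in [infsup] excludes. *)
Lemma Qdual_norm_null w : norm2 w = 0 -> Qdual_norm j w = 0.
Proof.
move=> w0; apply/eqP; rewrite eq_le Qdual_norm_ge0 andbT.
apply: ge_sup; first by exists 0; exact: Qdual_set0.
by move=> _ [q _ <-]; rewrite ip2_null// normr0.
Qed.

(** Since the inf-sup constant strictly exceeds [mu0], some [v] has quotient above [mu0], so the
    supremum need not be attained; clearing denominators leaves the bound. *)
Lemma infsup_Qdual_norm_le (Vh : set V) (Wh : set (L2 mu m)) (mu0 K : R) w :
  0 < mu0 -> (mu0%:E < infsup j B Vh Wh)%E -> 0 <= K -> Wh w ->
  (forall v, Vh v -> bform j B v w <= K * `|v|) ->
  mu0 * Qdual_norm j w <= K.
Proof.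
move=> mu00 hinf K0 Whw bK.
have [w0|w0] := eqVneq (norm2 w) 0; first by rewrite Qdual_norm_null// mulr0.
have /(lt_le_trans hinf) : (infsup j B Vh Wh <=
    ereal_sup [set (bform j B v w / (`|v| * Qdual_norm j w))%R%:E |
      v in [set v | Vh v /\ (v != 0)%R]])%E.
  by apply: ereal_inf_lbound; exists w.
move=> /ereal_sup_gt[_ [v [Vv v0] <-]]; rewrite lte_fin => mu0lt.
have vgt0 : 0 < `|v| by rewrite normr_gt0.
(* If it vanished, the quotient would be 0 by the convention on inverses, against [0 < mu0]. *)
have D0 : 0 < Qdual_norm j w.
  rewrite lt_neqAle Qdual_norm_ge0 andbT eq_sym; apply/eqP => D0.
  by move: mu0lt; rewrite D0 mulr0 invr0 mulr0 ltNge (ltW mu00).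
move: mu0lt; rewrite ltr_pdivlMr ?mulr_gt0// => /ltW/le_trans/(_ (bK _ Vv)).
by rewrite mulrCA mulrC ler_pM2r.
Qed.

End dual_norm_estimates.

(** Eliminating [D] leaves [C x^2 <= a x + e], and Young's inequality absorbs [a x]. [K] is chosen
    before [x] and [D], which makes the final constant uniform. *)
Lemma quadratic_linear_bound (R : realType) (C M f beta mu0 : R) :
  0 < C -> 0 <= M -> 0 <= f -> 0 <= beta -> 0 < mu0 ->
  exists K : R, forall x D : R, 0 <= x ->
    C * x ^+ 2 <= f * x + D * beta -> mu0 * D <= M * x + f ->
    x ^+ 2 + D <= K.
Proof.
move=> C0 M0 f0 beta0 mu00.
pose a := f + beta * M / mu0; pose e := beta * f / mu0.
pose X := (a ^+ 2 / C + 2 * e) / C.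
exists (X + (M * (1 + X) + f) / mu0) => x D x0 energy infsup.
have DM : D <= (M * x + f) / mu0 by rewrite ler_pdivlMr// mulrC.
have Dbeta := ler_wpM2r beta0 DM.
have xX : x ^+ 2 <= X.
  rewrite ler_pdivlMr// -(ler_pM2r C0) mulrDl divfK ?gt_eqF//.
  have Cxa : C * x ^+ 2 <= a * x + e.
    have -> : a * x + e = f * x + (M * x + f) / mu0 * beta by rewrite /a /e; ring.
    lra.
  have := ler_wpM2l (ltW C0) Cxa; have := sqr_ge0 (C * x - a); lra.
(* A bound on [x] without a square root, from [2 x <= x^2 + 1]. *)
have xX1 : x <= 1 + X by have := sqr_ge0 (x - 1); nra.
rewrite lerD// (le_trans DM)// ler_pM2r ?invr_gt0// lerD2r.
exact: ler_wpM2l.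
Qed.

(** * Averaged multiplier equation and summed energy estimate for the iteration *)

Section proximal_iteration.
Context {disp : measure_display} {T : measurableType disp} {R : realType}.
Context {mu : {measure set T -> \bar R}} {m : nat}.
Context {V Q : normedModType R} (j : {linear Q -> L2 mu m}) (B : {linear V -> Q}).
Variables (A : V -> V -> R) (F : V -> R) (Rf : T -> 'rV[R]_m -> \bar R).
Hypothesis A_linear : forall v a x y, A (a *: x + y) v = a * A x v + A y v.
Hypothesis F_linear : forall a x y, F (a *: x + y) = a * F x + F y.
Variables (Vh : set V) (Wh : set (L2 mu m)).
Hypothesis Wh_fin : findim_subspace Wh.
Variables (alpha : nat -> R) (u : nat -> V) (psi : nat -> L2 mu m) (v0 : V).
Hypothesis alpha_gt0 : forall k, (1 <= k)%N -> 0 < alpha k.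
Hypothesis psi0_in : Wh (psi 0%N).
Hypothesis hv0 : grad_conj mu Rf (vval (psi 0%N)) (vval (j (B v0))).
Hypothesis hstep : forall k, (1 <= k)%N ->
  proximal_step j B A F Rf Vh Wh (alpha k) (psi k.-1) (u k) (psi k).

Let s l := \sum_(1 <= k < l.+1) alpha k.
Let lambda := multiplier alpha psi.

Let u_in k : (1 <= k)%N -> Vh (u k).
Proof. by move=> /hstep[]. Qed.

Let psi_in k : Wh (psi k).
Proof. by case: k => // k; have [] := hstep (ltn0Sn k). Qed.

Let alpha_lambda k : (1 <= k)%N -> psi k - psi k.-1 = - alpha k *: lambda k.
Proof.
move=> k1; rewrite /lambda /multiplier scaleNr scalerA.
by rewrite divff ?gt_eqF ?alpha_gt0// scale1r opprB.
Qed.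

Lemma multiplier_in k : Wh (multiplier alpha psi k).
Proof.
have Wh0 : Wh 0 by rewrite -(addNr (psi 0%N)) -scaleN1r; exact: findim_subspace_linear.
rewrite /multiplier -[X in Wh X]addr0.
apply: findim_subspace_linear => //; rewrite addrC -scaleN1r.
exact: findim_subspace_linear.
Qed.

Lemma wavg_multiplier_equation l v : (1 <= l)%N -> Vh v ->
  bform j B v (wavg alpha lambda l) = A (wavg alpha u l) v - F v.
Proof.
move=> l1 Vv; have s0 := sum_weights_gt0 alpha_gt0 l1.
rewrite /bform (@linear_wavg _ _ (ip2 (j (B v)))); last first.
  by move=> a x y; rewrite ip2Dr ip2Zr.
rewrite (@linear_wavg _ _ (A ^~ v)); last exact: A_linear.
(* [F v] is written as its own weighted average, so the identity can be checked step by step. *)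
rewrite -[F v](mulKf (lt0r_neq0 s0)) -mulrBr; congr (_ * _).
rewrite mulr_suml -sumrB big_nat_cond [RHS]big_nat_cond.
apply: eq_bigr => k /andP[/andP[k1 _] _].
have [_ _ /(_ _ Vv) + _] := hstep k1.
rewrite /bform alpha_lambda// ip2Zr; lra.
Qed.

Lemma proximal_energy_le l : (1 <= l)%N ->
  \sum_(1 <= k < l.+1) alpha k * A (u k) (u k) <=
  s l * (F (wavg alpha u l) + ip2 (j (B v0)) (wavg alpha lambda l)).
Proof.
move=> l1; have s0 := sum_weights_gt0 alpha_gt0 l1.
(* Index 0 solves no discrete problem; its gradient is [j (B v0)] by hypothesis. *)
have /choice[g hg] : forall k, exists g : L2 mu m,
    grad_conj mu Rf (vval (psi k)) (vval g) /\
    (if k is 0%N then g = j (B v0) else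
      forall w, Wh w -> bform j B (u k) w = ip2 g w).
  move=> [|k]; first by exists (j (B v0)).
  have [_ _ _ [g gP gW]] := hstep (ltn0Sn k).
  by exists g; split => // w /gW /eqP; rewrite subr_eq0 => /eqP.
have : ip2 (g 0%N) (psi l - psi 0%N) <=
    \sum_(1 <= k < l.+1) ip2 (g k) (psi k - psi k.-1).
  apply: le_ip2_sum.
  (* Countably many indices share one null set, off which cyclic monotonicity applies pointwise. *)
  have := @ae_foralln _ _ _ mu _ (fun k => (hg k).1).
  apply: filterS => x /(cyclic_monotone l) /=; rewrite -vvalB.
  by under eq_bigr do rewrite -vvalB.
have [_ ->] := hg 0%N.
have -> : psi l - psi 0%N = - (s l *: wavg alpha lambda l).
  rewrite /lambda wavg_multiplier// scalerA divff ?gt_eqF//.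
  by rewrite scale1r opprB.
rewrite -scaleNr ip2Zr mulNr => mono.
(* The first equation is tested with [u k], the constraint with [psi k - psi k.-1], which lies in
   [Wh]. *)
have : \sum_(1 <= k < l.+1) alpha k * A (u k) (u k) +
    \sum_(1 <= k < l.+1) ip2 (g k) (psi k - psi k.-1) = s l * F (wavg alpha u l).
  rewrite linear_wavg// mulVKf ?gt_eqF// -big_split big_nat_cond [RHS]big_nat_cond.
  apply: eq_bigr => -[|k] // _; have [_ _ /(_ _ (u_in _)) <- // _] := hstep (ltn0Sn k).
  congr (_ + _); have [_ <- //] := hg k.+1.
  by rewrite addrC -scaleN1r; exact: findim_subspace_linear.
rewrite mulrDr; lra.
Qed.

End proximal_iteration.

(** * The stability bound for the averaged iterates *)

Theorem lemma3p2 (R : realType) (n m : nat)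
  (hn : (0 < n <= 3)%N)
  (Omega : set 'rV[R]_n)
  (hOmega : bounded_lipschitz_domain Omega)
  (d : R) (Omegad : set (hspace n d))
  (mOmegad : measurable Omegad)
  (hOmegad : Omegad `<=` closure Omega)
  (hdim : hausdorff_dim Omegad = d%:E) (hd : d <= n%:R)
  (mu := hausdorff_on mOmegad)
  (V : completeNormedModType R) (ip : {dot V for @idfun R})
  (hip : forall v : V, ip v v = `|v| ^+ 2)
  (Lop : V -> {linear V -> R^o})
  (hLop : forall u, continuous (Lop u))
  (hLlin : forall (a : R) (u u' v : V),
     Lop (a *: u + u') v = a * Lop u v + Lop u' v)
  (F : {linear V -> R^o}) (hF : continuous F)
  (A := fun u v : V => Lop u v : R)
  (c1 Cbnd Ccoerc : R) (hc1 : 0 <= c1) (hCbnd : 0 < Cbnd) (hCcoerc : 0 < Ccoerc)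
  (hskew : forall u v : V, skew_part A u v <= c1 * `|u| * `|v|)
  (hsymm : forall u v : V, symm_part A u v <= Cbnd * `|u| * `|v|)
  (hcoerc : forall u : V, Ccoerc * `|u| ^+ 2 <= A u u)
  (Q : normedModType R) (j : {linear Q -> L2 mu m}) (hj : dense_embedding j)
  (B : {linear V -> Q}) (hB : continuous B) (hBsurj : range B = setT)
  (C : hspace n d -> set 'rV[R]_m)
  (hC : \forall x \ae mu, [/\ closed (C x),
     convex_set (C x : set (convex_lmodType 'rV[R]_m)) & interior (C x) !=set0])
  (Rf : hspace n d -> 'rV[R]_m -> \bar R)
  (hRcar : caratheodory_integrand mu Omegad Rf)
  (hRleg : \forall x \ae mu,
     [/\ legendre (Rf x), edom (Rf x) = C x & supercoercive (Rf x)])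
  (hRconj : grad_conj_regular mu C Rf)
  (H : Type) (Vh : H -> set V) (Wh : H -> set (L2 mu m))
  (hVh : forall h, findim_subspace (Vh h))
  (hWh : forall h, findim_subspace (Wh h))
  (mu0 : R) (hmu0 : 0 < mu0)
  (hinfsup : forall h, (mu0%:E < infsup j B (Vh h) (Wh h))%E)
  (psi0 : H -> L2 mu m) (hpsi0 : forall h, Wh h (psi0 h))
  (c : R)
  (hc : forall h, exists2 v : V,
     grad_conj mu Rf (vval (psi0 h)) (vval (j (B v))) & `|v| <= c) :
  exists Cstab : R,
    forall (h : H) (alpha : nat -> R) (u : nat -> V) (psi : nat -> L2 mu m),
      (forall k, (1 <= k)%N -> 0 < alpha k) ->
      psi 0%N = psi0 h ->
      (forall k, (1 <= k)%N ->
         proximal_step j B A F Rf (Vh h) (Wh h) (alpha k) (psi k.-1)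
           (u k) (psi k)) ->
      forall l, (1 <= l)%N ->
        `|wavg alpha u l| ^+ 2
          + Qdual_norm j (wavg alpha (multiplier alpha psi) l) <= Cstab.
Proof.
have [KB KB0 hKB] := linear_continuous_bound hB.
have [KF KF0 hKF] := linear_continuous_bound hF.
have M0 : 0 <= Cbnd + c1 by rewrite addr_ge0// ltW.
(* The absolute value is taken because [c] could be negative when [H] is empty. *)
have beta0 : 0 <= KB * `|c| by rewrite mulr_ge0.
have A_linear v a x y : A (a *: x + y) v = a * A x v + A y v by exact: hLlin.
have F_linear a x y : F (a *: x + y) = a * F x + F y :> R by rewrite linearP.
have A_le x y : A x y <= (Cbnd + c1) * `|x| * `|y|.
  have -> : A x y = symm_part A x y + skew_part A x y.
    by rewrite /symm_part /skew_part; lra.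
  by rewrite !mulrDl; exact: lerD.
have [K hK] := quadratic_linear_bound hCcoerc M0 KF0 beta0 hmu0.
exists K => h alpha u psi alpha0 psi0E hstep l l1.
have [v0 gv0 v0c] := hc h.
have psi0W : Wh h (psi 0%N) by rewrite psi0E.
rewrite -psi0E in gv0.
have s0 := sum_weights_gt0 alpha0 l1.
apply: hK => //.
- have energy := proximal_energy_le F_linear (hWh h) alpha0 psi0W gv0 hstep l1.
  have jensen := sqr_norm_wavg_le u alpha0 l1.
  (* Multiplying by the total weight allows the chain Jensen, coercivity, energy estimate. *)
  rewrite -(ler_pM2l s0) mulrCA.
  apply: le_trans (ler_wpM2l (ltW hCcoerc) jensen) _.
  apply: (@le_trans _ _ (\sum_(1 <= k < l.+1) alpha k * A (u k) (u k))).
    rewrite mulr_sumr big_nat_cond [leRHS]big_nat_cond; apply: ler_sum => k.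
    by move=> /andP[/andP[k1 _] _]; rewrite mulrCA ler_pM2l ?alpha0.
  apply: le_trans energy _; rewrite ler_pM2l// lerD//.
    exact: le_trans (ler_norm _) (hKF _).
  rewrite ip2C (le_trans (ler_norm _))// (le_trans (norm_ip2_embed_le hj _ _))//.
  rewrite ler_wpM2l ?Qdual_norm_ge0// (le_trans (hKB _))// ler_wpM2l//.
  exact: le_trans (ler_norm _).
(* The averaged multiplier lies in [Wh h], and its equation bounds [bform] by
   [(Cbnd + c1) |u_avg| + KF] times the norm of [v]. *)
- apply: (infsup_Qdual_norm_le hj hmu0 (hinfsup h)).
  + by rewrite addr_ge0// mulr_ge0.
  + apply: (wavg_in _ _ (hWh h)) => k _.
    exact: (multiplier_in (hWh h) psi0W hstep).
  + move=> v Vv.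
    rewrite (wavg_multiplier_equation A_linear alpha0 hstep l1 Vv).
    rewrite mulrDl lerD//.
    by apply: le_trans (hKF v); rewrite -normrN ler_norm.
Qed.
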